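(* Let $a<b$ be real numbers and let $x^{*}:C([a,b];\mathbb{R}_{\mathcal F})\to\mathbb{R}$ be a map. Then $x^{*}$ is a linear continuous functional (continuity with respect to the metric $D^{*}$) if and only if there exists a linear functional $L:C([a,b];\overline{C}[0,1])\to\mathbb{R}$ such that $$x^{*}(x)=L(x_{-}+x_{+})\quad\text{for all } x\in C([a,b];\mathbb{R}_{\mathcal F}),$$ and such that the restriction of $L$ to $CIC[0,1]$ is continuous on $CIC[0,1]$ with respect to the metric on $C([a,b];\overline{C}[0,1])$ given by $$\Delta(F,G)=\sup\{\|F(t)-G(t)\|: t\in[a,b]\},$$ where $\|\cdot\|$ is the uniform norm on $\overline{C}[0,1]$.
   Context: Fuzzy numbers: $\mathbb{R}_{\mathcal F}$ is the set of all functions $u:\mathbb{R}\to[0,1]$ such that (i) there is $x_u\in\mathbb{R}$ with $u(x_u)=1$; (ii) $u(tx+(1-t)y)\ge\min\{u(x),u(y)\}$ for all $t\in[0,1]$, $x,y\in\mathbb{R}$; (iii) $u$ is upper semicontinuous on $\mathbb{R}$; (iv) the closure of $\{x\in\mathbb{R}: u(x)>0\}$ is compact. Level sets: for $0<r\le 1$, $[u]^r=\{x\in\mathbb{R}:u(x)\ge r\}$, and $[u]^0=\overline{\{x\in\mathbb{R}:u(x)>0\}}$. Each $[u]^r$ is a compact interval, written $[u]^r=[u_-(r),u_+(r)]$; this defines functions $u_-,u_+:[0,1]\to\mathbb{R}$, which belong to the space $\overline{C}[0,1]$ below. Operations: $(u\oplus v)(x)=\sup_{y+z=x}\min\{u(y),v(z)\}$;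 for $\lambda\in\mathbb{R}$, $(\lambda\odot u)(x)=u(x/\lambda)$ if $\lambda\ne0$, and $0\odot u=\widetilde 0:=\chi_{\{0\}}$. Equivalently, $[u\oplus v]^r=[u]^r+[v]^r$ and $[\lambda\odot u]^r=\lambda[u]^r$ for all $r\in[0,1]$. Metric: $D(u,v)=\sup_{r\in[0,1]}\max\{|u_-(r)-v_-(r)|,|u_+(r)-v_+(r)|\}$. $C([a,b];\mathbb{R}_{\mathcal F})$ is the set of functions $f:[a,b]\to\mathbb{R}_{\mathcal F}$ continuous on $[a,b]$ (with respect to $D$), with pointwise operations $\oplus,\odot$ and the metric $D^{*}(f,g)=\sup\{D(f(t),g(t)):t\in[a,b]\}$. A functional $A:C([a,b];\mathbb{R}_{\mathcal F})\to\mathbb{R}$ is called linear if $A(x\oplus y)=A(x)+A(y)$ and $A(\lambda\odot x)=\lambda A(x)$ for all $x,y\in C([a,b];\mathbb{R}_{\mathcal F})$ and all $\lambda\in\mathbb{R}$. Continuous means continuous at every point. $\overline{C}[0,1]$ is the real Banach space of all bounded functions $f:[0,1]\to\mathbb{R}$ that are left continuous at each point of $(0,1]$, have a right limit at each point of $[0,1)$, and are right continuous at $0$, with the uniform norm $\|f\|=\sup\{|f(x)|:x\in[0,1]\}$ and the metric $\Gamma(f,g)=\|f-g\|$. $IC[0,1]=\{f\in\overline{C}[0,1]: f\text{ is increasing on }[0,1]\}$, where increasing means nondecreasing. $C([a,b];\overline{C}[0,1])=\{F:[a,b]\to\overline{C}[0,1]: F\text{ is continuous on }[a,b]\}$, a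 real vector space under pointwise operations, and $CIC[0,1]=\{F\in C([a,b];\overline{C}[0,1]): F(t)\in IC[0,1]\ \forall t\in[a,b]\}$. $L$ is linear in the usual vector space sense. For $x\in C([a,b];\mathbb{R}_{\mathcal F})$, the functions $x_-,x_+:[a,b]\to\overline{C}[0,1]$ are defined by $[x_-(t)](r)=[x(t)]_-(r)$ and $[x_+(t)](r)=[x(t)]_+(r)$ for $t\in[a,b]$, $r\in[0,1]$; they belong to $C([a,b];\overline{C}[0,1])$. *)

(* Defs.v *)
From HB Require Import structures.
From mathcomp Require Import all_boot all_order all_algebra.
From mathcomp Require Import all_classical all_reals topology normedtype derive.
From mathcomp Require Import ring lra.

Set Implicit Arguments.
Unset Strict Implicit.
Unset Printing Implicit Defensive.

Import Order.TTheory GRing.Theory Num.Theory.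
Import numFieldNormedType.Exports.

Local Open Scope classical_set_scope.
Local Open Scope ring_scope.

Section FuzzyNumbers.
Variable R : realType.

Record is_fuzzy (u : R -> R) : Prop := IsFuzzy {
  fuzzy_itv01 : forall x, 0 <= u x <= 1;
  fuzzy_normal : exists x, u x = 1;
  fuzzy_qconcave : forall t x y, 0 <= t <= 1 ->
    Num.min (u x) (u y) <= u (t * x + (1 - t) * y);
  fuzzy_usc : forall x c, u x < c -> \forall y \near x, u y < c;
  fuzzy_cpt : compact (closure [set x | 0 < u x])
}.

Record fuzzy := Fuzzy { fuzzy_fun :> R -> R ; fuzzyP : is_fuzzy fuzzy_fun }.

HB.instance Definition _ := gen_eqMixin fuzzy.
HB.instance Definition _ := gen_choiceMixin fuzzy.

(* [u]^r; only used for r in [0, 1]. *)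
Definition level (u : R -> R) (r : R) : set R :=
  if 0 < r then [set x | r <= u x] else closure [set x | 0 < u x].

(* u_-(r) and u_+(r): by levelE below, [u]^r = [level_inf u r, level_sup u r]. *)
Definition level_inf (u : R -> R) (r : R) : R := inf (level u r).
Definition level_sup (u : R -> R) (r : R) : R := sup (level u r).

Definition fadd_fun (u v : R -> R) (x : R) : R :=
  sup [set Num.min (u p.1) (v p.2) | p in [set p : R * R | p.1 + p.2 = x]].

Definition fscale_fun (l : R) (u : R -> R) (x : R) : R :=
  if l == 0 then (x == 0)%:R else u (x / l).

Lemma fuzzy_eqP (u v : fuzzy) : u =1 v -> u = v.
Proof.
case: u v => [u pu] [v pv] /= /funext uv; subst v.
by congr Fuzzy; exact: Prop_irrelevance.
Qed.

Section Levels.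
Variable u : fuzzy.

Let supp := [set x | 0 < u x].

Lemma fuzzy_between x y z : x <= z <= y -> Num.min (u x) (u y) <= u z.
Proof.
move=> /andP[xz zy]; have [xy|] := ltP x y; last first.
  move=> yx; have -> : x = z by apply/le_anti; rewrite xz (le_trans zy).
  by rewrite ge_min lexx.
have yx0 : 0 < y - x by rewrite subr_gt0.
have -> : z = ((y - z) / (y - x)) * x + (1 - (y - z) / (y - x)) * y.
  by field; rewrite gt_eqF.
apply: (fuzzy_qconcave (fuzzyP u)).
by rewrite divr_ge0 ?subr_ge0 ?(ltW xy)//= ler_pdivrMr// mul1r lerD2l lerN2.
Qed.

Lemma level_interval r : is_interval (level u r).
Proof.
rewrite /level; case: ifPn => r0.
  move=> x y /= rx ry z /fuzzy_between; apply: le_trans.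
  by rewrite le_min rx.
apply/connected_intervalP/connected_closure/connected_intervalP.
move=> x y /= rx ry z /fuzzy_between; apply: lt_le_trans.
by rewrite lt_min rx.
Qed.

Lemma level_closed r : closed (level u r).
Proof.
rewrite /level; case: ifPn => r0; last exact: closed_closure.
rewrite (_ : [set x | _] = ~` [set x | u x < r]); last first.
  by apply/seteqP; split=> x /=; rewrite leNgt => /negP.
apply: open_closedC; rewrite openE => x /= /(fuzzy_usc (fuzzyP u)).
exact.
Qed.

Lemma level0_sub r : level u r `<=` closure supp.
Proof.
rewrite /level; case: ifPn => r0 //= x /= rx; apply: subset_closure.
by rewrite /supp/=; exact: lt_le_trans rx.
Qed.

Lemma level_nonempty r : r <= 1 -> level u r !=set0.
Proof.
move=> r1; have [x ux] := fuzzy_normal (fuzzyP u); exists x.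
rewrite /level; case: ifPn => _ /=; first by rewrite ux.
by apply: subset_closure; rewrite /= ux.
Qed.

Lemma level_bounded : exists M, forall r x, level u r x -> `|x| <= M.
Proof.
have [M [_ HM]] := compact_bounded (fuzzy_cpt (fuzzyP u)).
exists (M + 1) => r x /level0_sub xs; apply: (HM (M + 1)) => //.
by rewrite ltrDl.
Qed.

Lemma level_ubound r : has_ubound (level u r).
Proof.
have [M HM] := level_bounded; exists M => x /HM.
by rewrite ler_norml => /andP[].
Qed.

Lemma level_lbound r : has_lbound (level u r).
Proof.
have [M HM] := level_bounded; exists (- M) => x /HM.
by rewrite ler_norml => /andP[].
Qed.

Lemma level_inf_in r : r <= 1 -> level u r (level_inf u r).
Proof.
move=> r1; rewrite /level_inf {1}((closure_id _).1 (@level_closed r)).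
have ne := level_nonempty r1; have lb := level_lbound r.
rewrite /inf; set A := level u r in ne lb *.
have : closure (-%R @` A) (sup (-%R @` A)).
  by apply: closure_sup; [exact/nonemptyN|exact/has_lb_ubN].
move=> cN B /(@oppr_continuous _ R) nB.
by have [y [[x Ax <-]]] := cN _ nB; rewrite /= opprK => Bx; exists x.
Qed.

Lemma level_sup_in r : r <= 1 -> level u r (level_sup u r).
Proof.
move=> r1; rewrite /level_sup {1}((closure_id _).1 (@level_closed r)).
by apply: closure_sup; [exact: level_nonempty|exact: level_ubound].
Qed.

Lemma levelE r : r <= 1 -> level u r = `[level_inf u r, level_sup u r]%classic.
Proof.
move=> r1; apply/seteqP; split=> x /=; rewrite in_itv /=.
  move=> Lx; apply/andP; split.
    exact: ge_inf (level_lbound r) _ Lx.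
  exact: ub_le_sup (level_ubound r) _ Lx.
by apply: level_interval; [exact: level_inf_in|exact: level_sup_in].
Qed.

Lemma le_fuzzyE r x : 0 < r <= 1 ->
  (r <= u x) = (level_inf u r <= x <= level_sup u r).
Proof.
move=> /andP[r0 r1]; have := levelE r1; rewrite {1}/level r0.
move=> /(congr1 (fun A : set R => A x)) /=; rewrite in_itv/= => E.
by apply/idP/idP; rewrite E.
Qed.

Lemma level_inf_sup r : r <= 1 -> level_inf u r <= level_sup u r.
Proof.
move=> r1; apply: ge_inf; first exact: level_lbound.
exact: level_sup_in.
Qed.

Lemma level_le r s : r <= s -> level u s `<=` level u r.
Proof.
move=> rs; rewrite {2}/level; case: ifPn => r0; last exact: level0_sub.
by rewrite /level (lt_le_trans r0 rs) => x /=; exact: le_trans.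
Qed.

Lemma level_inf_nd r s : r <= s -> s <= 1 -> level_inf u r <= level_inf u s.
Proof.
move=> rs s1; apply: ge_inf; first exact: level_lbound.
by apply: (level_le rs); exact: level_inf_in.
Qed.

Lemma level_sup_ni r s : r <= s -> s <= 1 -> level_sup u s <= level_sup u r.
Proof.
move=> rs s1; apply: ub_le_sup; first exact: level_ubound.
by apply: (level_le rs); exact: level_sup_in.
Qed.

Let le_from_below r x : (forall s, 0 < s < r -> s <= u x) -> 0 < r -> r <= u x.
Proof.
move=> H r0; rewrite leNgt; apply/negP => uxr.
have ux0 : 0 <= u x by have /andP[] := fuzzy_itv01 (fuzzyP u) x.
have := H ((u x + r) / 2); rewrite leNgt => /(_ _)/negP; apply; lra.
Qed.

Lemma level_inf_left r c : 0 < r <= 1 -> c < level_inf u r ->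
  exists2 s, 0 < s < r & c < level_inf u s.
Proof.
move=> /andP[r0 r1] clo; apply: contrapT => /forall2NP H.
suff : r <= u c by rewrite le_fuzzyE ?r0// leNgt clo.
apply: le_from_below => // s /[dup] s0r /andP[s0 sr].
have s1 : s <= 1 by rewrite (le_trans (ltW sr)).
rewrite le_fuzzyE ?s0 ?s1//; apply/andP; split.
  by have [/(_ s0r)//|/negP] := H s; rewrite -leNgt.
rewrite (le_trans (ltW clo))// (le_trans (level_inf_sup r1))//.
exact: level_sup_ni (ltW sr) _.
Qed.

Lemma level_sup_left r c : 0 < r <= 1 -> level_sup u r < c ->
  exists2 s, 0 < s < r & level_sup u s < c.
Proof.
move=> /andP[r0 r1] clo; apply: contrapT => /forall2NP H.
suff : r <= u c by rewrite le_fuzzyE ?r0// [c <= _]leNgt clo andbF.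
apply: le_from_below => // s /[dup] s0r /andP[s0 sr].
have s1 : s <= 1 by rewrite (le_trans (ltW sr)).
rewrite le_fuzzyE ?s0 ?s1//; apply/andP; split; last first.
  by have [/(_ s0r)//|/negP] := H s; rewrite -leNgt.
rewrite (le_trans _ (ltW clo))// (le_trans _ (level_inf_sup r1))//.
exact: level_inf_nd (ltW sr) _.
Qed.

Let level_0P (B : set R) x : closure supp x -> nbhs x B ->
  exists y s, [/\ B y, 0 < s <= 1 & level u s y].
Proof.
move=> cx nB; have [y [/= uy By]] := cx _ nB; exists y, (u y); split => //.
  by rewrite uy; have /andP[] := fuzzy_itv01 (fuzzyP u) y.
by rewrite /level; case: ifPn => //=; rewrite uy.
Qed.

Lemma level_inf_right0 c : level_inf u 0 < c ->
  exists2 s, 0 < s <= 1 & level_inf u s < c.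
Proof.
move=> cl; have := level_inf_in ler01; rewrite {1}/level ltxx.
move=> /level_0P/(_ (lt_nbhsl cl))[y [s [yc s01 sy]]].
exists s => //; apply: le_lt_trans yc.
exact: ge_inf (level_lbound s) _ sy.
Qed.

Lemma level_sup_right0 c : c < level_sup u 0 ->
  exists2 s, 0 < s <= 1 & c < level_sup u s.
Proof.
move=> cl; have := level_sup_in ler01; rewrite {1}/level ltxx.
move=> /level_0P/(_ (lt_nbhsr cl))[y [s [yc s01 sy]]].
exists s => //; apply: lt_le_trans yc _.
exact: ub_le_sup (level_ubound s) _ sy.
Qed.

End Levels.

Section Build.
Variables (w l h : R -> R).
Hypothesis w01 : forall x, 0 <= w x <= 1.
Hypothesis lwh : forall r x, 0 < r <= 1 -> (r <= w x) = (l r <= x <= h r).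
Hypothesis lh1 : l 1 <= h 1.
Hypothesis lhM : exists M, forall r, 0 < r <= 1 -> - M <= l r /\ h r <= M.

Lemma is_fuzzy_of_levels : is_fuzzy w.
Proof.
split => //.
- exists (l 1); apply/le_anti; have /andP[_ ->] := w01 (l 1).
  by rewrite lwh ?lexx ?ltr01.
- move=> t x y t01; rewrite leNgt; apply/negP => wlt.
  have := w01 (t * x + (1 - t) * y) => /andP[w0 _].
  set r := Num.min (w x) (w y) in wlt.
  have r01 : 0 < r <= 1.
    rewrite (le_lt_trans w0 wlt)/= /r ge_min.
    by have /andP[_ ->] := w01 x.
  have := wlt; rewrite ltNge => /negP; apply; rewrite lwh//.
  have : r <= w x by rewrite /r ge_min lexx.
  have : r <= w y by rewrite /r ge_min lexx orbT.
  rewrite !lwh// => /andP[? ?] /andP[? ?]; nra.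
- move=> x c wc; have [c1|c1] := ltP 1 c.
    by apply: (@nearW _ (nbhs x)) => y; have /andP[_ wy] := w01 y; exact: le_lt_trans c1.
  have c01 : 0 < c <= 1 by rewrite c1 andbT; have /andP[/le_lt_trans->] := w01 x.
  have : ~~ (c <= w x) by rewrite -ltNge.
  rewrite lwh// negb_and -!ltNge => /orP[xl|hx].
    apply: filterS (lt_nbhsl xl) => y yl.
    by rewrite ltNge lwh// negb_and -!ltNge yl.
  apply: filterS (lt_nbhsr hx) => y hy.
  by rewrite ltNge lwh// negb_and -!ltNge hy orbT.
- have [M HM] := lhM.
  apply: (@subclosed_compact _ _ `[- M, M]%classic).
  + exact: closed_closure.
  + exact: segment_compact.
  + have : closed `[- M, M]%classic by exact: itv_closed.
    move/closure_id => ->; apply: closureS => x /= wx.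
    have wx1 : 0 < w x <= 1 by rewrite wx; have /andP[_] := w01 x.
    have := lexx (w x); rewrite lwh// in_itv/= => /andP[lx xh].
    by have [Ml hM] := HM _ wx1; rewrite (le_trans Ml)// (le_trans _ hM).
Qed.

Lemma level_of_levels r : 0 < r <= 1 -> l r <= h r ->
  level_inf w r = l r /\ level_sup w r = h r.
Proof.
move=> r01 lh; rewrite /level_inf /level_sup /level.
have /andP[-> _] := r01.
rewrite (_ : [set x | _] = `[l r, h r]%classic); last first.
  by apply/seteqP; split=> x /=; rewrite lwh// in_itv.
by rewrite inf_itv// sup_itv.
Qed.

End Build.

Section Sum.
Variables u v : fuzzy.

Let S x := [set Num.min (u p.1) (v p.2) | p in [set p : R * R | p.1 + p.2 = x]].

Let S01 x z : S x z -> 0 <= z <= 1.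
Proof.
move=> [p _ <-]; rewrite le_min ge_min.
have /andP[-> ->] := fuzzy_itv01 (fuzzyP u) p.1.
by have /andP[-> _] := fuzzy_itv01 (fuzzyP v) p.2.
Qed.

Let hsS x : has_sup (S x).
Proof.
split; first by exists (Num.min (u x) (v 0)); exists (x, 0) => //=; rewrite addr0.
by exists 1 => z /S01/andP[].
Qed.

Let sum01 x : 0 <= fadd_fun u v x <= 1.
Proof.
apply/andP; split.
  have [[z Sz] ub] := hsS x; have /andP[z0 _] := S01 Sz.
  exact: le_trans z0 (ub_le_sup ub Sz).
by apply: ge_sup; [exact: (hsS x).1|move=> z /S01/andP[]].
Qed.

Let l r := level_inf u r + level_inf v r.
Let h r := level_sup u r + level_sup v r.

Let lh r : r <= 1 -> l r <= h r.
Proof. by move=> r1; apply: lerD; exact: level_inf_sup. Qed.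

Lemma le_fadd_funE r x : 0 < r <= 1 ->
  (r <= fadd_fun u v x) = (l r <= x <= h r).
Proof.
move=> /[dup] r01 /andP[r0 r1]; apply/idP/idP; last first.
  rewrite /l /h => /andP[lx xh].
  have iu := level_inf_sup u r1; have iv := level_inf_sup v r1.
  have [y yu xyv] : exists2 y, level_inf u r <= y <= level_sup u r &
                               level_inf v r <= x - y <= level_sup v r.
    have [H|H] := leP (level_inf u r) (x - level_sup v r).
      by exists (x - level_sup v r); lra.
    by exists (level_inf u r); lra.
  move: yu xyv; rewrite -!le_fuzzyE// => yu xyv.
  apply: (@le_trans _ _ (Num.min (u y) (v (x - y)))); first by rewrite le_min yu.
  apply: ub_le_sup; first exact: (hsS x).2.
  by exists (y, x - y) => //=; rewrite addrC subrK.
move=> rx.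
have H s : 0 < s < r -> l s <= x <= h s.
  move=> /andP[s0 sr]; have s01 : 0 < s <= 1 by rewrite s0 (le_trans (ltW sr)).
  have [_ [[y z] /= yz <-]] := sup_gt (hsS x).1 (lt_le_trans sr rx).
  move=> /ltW; rewrite le_min !le_fuzzyE// -yz /l /h.
  by move=> /andP[/andP[? ?] /andP[? ?]]; rewrite !lerD.
apply/andP; split; rewrite leNgt; apply/negP.
  rewrite /l => xl; pose d := (level_inf u r + level_inf v r - x) / 2.
  have d0 : 0 < d by rewrite /d; lra.
  have [|s /andP[s0 sr] sc] := @level_inf_left u r (level_inf u r - d) r01; first by lra.
  have [|t /andP[t0 tr] tc] := @level_inf_left v r (level_inf v r - d) r01; first by lra.
  have [st|ts] := leP s t.
    have := H t; rewrite t0 tr => /(_ isT); rewrite /l => /andP[? _].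
    have := level_inf_nd u st (le_trans (ltW tr) r1); rewrite /d in sc tc *; lra.
  have := H s; rewrite s0 sr => /(_ isT); rewrite /l => /andP[? _].
  have := level_inf_nd v (ltW ts) (le_trans (ltW sr) r1); rewrite /d in sc tc *; lra.
rewrite /h => xl; pose d := (x - level_sup u r - level_sup v r) / 2.
have d0 : 0 < d by rewrite /d; lra.
have [|s /andP[s0 sr] sc] := @level_sup_left u r (level_sup u r + d) r01; first by lra.
have [|t /andP[t0 tr] tc] := @level_sup_left v r (level_sup v r + d) r01; first by lra.
have [st|ts] := leP s t.
  have := H t; rewrite t0 tr => /(_ isT); rewrite /h => /andP[_ ?].
  have := level_sup_ni u st (le_trans (ltW tr) r1); rewrite /d in sc tc *; lra.
have := H s; rewrite s0 sr => /(_ isT); rewrite /h => /andP[_ ?].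
have := level_sup_ni v (ltW ts) (le_trans (ltW sr) r1); rewrite /d in sc tc *; lra.
Qed.

Lemma fadd_is_fuzzy : is_fuzzy (fadd_fun u v).
Proof.
apply: (is_fuzzy_of_levels sum01 le_fadd_funE); first exact: lh.
have [M HM] := level_bounded u; have [N HN] := level_bounded v.
exists (M + N) => r /andP[_ r1].
have := HM _ _ (level_inf_in u r1); have := HM _ _ (level_sup_in u r1).
have := HN _ _ (level_inf_in v r1); have := HN _ _ (level_sup_in v r1).
rewrite !ler_norml => /andP[? ?] /andP[? ?] /andP[? ?] /andP[? ?].
by rewrite /l /h; split; lra.
Qed.

Definition fadd := Fuzzy fadd_is_fuzzy.

Lemma level_fadd r : 0 < r <= 1 ->
  level_inf fadd r = level_inf u r + level_inf v r /\
  level_sup fadd r = level_sup u r + level_sup v r.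
Proof.
move=> r01; apply: (level_of_levels le_fadd_funE) => //.
by apply: lh; case/andP: r01.
Qed.

End Sum.

Section Scale.
Variables (a : R) (u : fuzzy).

Let l r := Num.min (a * level_inf u r) (a * level_sup u r).
Let h r := Num.max (a * level_inf u r) (a * level_sup u r).

Let lh r : l r <= h r.
Proof. by rewrite /l /h ge_min le_max lexx. Qed.

Let scale01 x : 0 <= fscale_fun a u x <= 1.
Proof.
rewrite /fscale_fun; case: eqP => _; last exact: fuzzy_itv01 (fuzzyP u) _.
by case: (x == 0); rewrite ?lexx ?ler01.
Qed.

Lemma le_fscale_funE r x : 0 < r <= 1 ->
  (r <= fscale_fun a u x) = (l r <= x <= h r).
Proof.
move=> /[dup] r01 /andP[r0 r1]; rewrite /fscale_fun /l /h.
have [a0|a0|->] := ltgtP a 0; rewrite ?eqxx ?(lt_eqF a0) ?(gt_eqF a0).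
- rewrite le_fuzzyE// ler_ndivlMr// ler_ndivrMr//.
  have H := level_inf_sup u r1.
  by rewrite min_r ?max_l ?ler_nM2l// andbC ![_ * a]mulrC.
- rewrite le_fuzzyE// ler_pdivlMr// ler_pdivrMr//.
  have H := level_inf_sup u r1.
  by rewrite min_l ?max_r ?ler_pM2l// ![_ * a]mulrC.
- rewrite !mul0r minxx maxxx -eq_le eq_sym.
  by case: eqP => _; rewrite ?r1// leNgt r0.
Qed.

Lemma fscale_is_fuzzy : is_fuzzy (fscale_fun a u).
Proof.
apply: (is_fuzzy_of_levels scale01 le_fscale_funE); first exact: lh.
have [M HM] := level_bounded u.
exists (`|a| * M) => r /andP[_ r1].
have H x : level u r x -> - (`|a| * M) <= a * x <= `|a| * M.
  by move=> /HM xM; rewrite -ler_norml normrM ler_wpM2l.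
have /andP[? ?] := H _ (level_inf_in u r1).
have /andP[? ?] := H _ (level_sup_in u r1).
by rewrite /l /h le_min ge_max; split; apply/andP.
Qed.

Definition fscale := Fuzzy fscale_is_fuzzy.

Lemma level_fscale r : 0 < r <= 1 ->
  level_inf fscale r = Num.min (a * level_inf u r) (a * level_sup u r) /\
  level_sup fscale r = Num.max (a * level_inf u r) (a * level_sup u r).
Proof. by move=> r01; exact: (level_of_levels le_fscale_funE). Qed.

End Scale.

End FuzzyNumbers.

Section FuzzyMetric.
Variable R : realType.
Implicit Types u v w : fuzzy R.

Definition fdist u v : R :=
  sup [set Num.max `|level_inf u r - level_inf v r|
                   `|level_sup u r - level_sup v r| | r in `[0, 1]%classic].

Let S u v := [set Num.max `|level_inf u r - level_inf v r|
                   `|level_sup u r - level_sup v r| | r in `[0, 1]%classic].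

Let S_has_sup u v : has_sup (S u v).
Proof.
split.
  by eexists; exists 0; [rewrite /= in_itv/= lexx ler01|reflexivity].
have [M HM] := level_bounded u; have [N HN] := level_bounded v.
exists (M + N) => z [r /=]; rewrite in_itv/= => /andP[_ r1] <-.
rewrite ge_max; apply/andP; split; apply: (le_trans (ler_normB _ _)); apply: lerD.
- exact: HM (level_inf_in u r1).
- exact: HN (level_inf_in v r1).
- exact: HM (level_sup_in u r1).
- exact: HN (level_sup_in v r1).
Qed.

Lemma level_inf_dist u v r : 0 <= r <= 1 ->
  `|level_inf u r - level_inf v r| <= fdist u v.
Proof.
move=> r01; apply: (@le_trans _ _ (Num.max `|level_inf u r - level_inf v r|
                   `|level_sup u r - level_sup v r|)).
  by rewrite le_max lexx.
by apply: ub_le_sup; [exact: (S_has_sup u v).2|exists r; rewrite //= in_itv].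
Qed.

Lemma level_sup_dist u v r : 0 <= r <= 1 ->
  `|level_sup u r - level_sup v r| <= fdist u v.
Proof.
move=> r01; apply: (@le_trans _ _ (Num.max `|level_inf u r - level_inf v r|
                   `|level_sup u r - level_sup v r|)).
  by rewrite le_max lexx orbT.
by apply: ub_le_sup; [exact: (S_has_sup u v).2|exists r; rewrite //= in_itv].
Qed.

Let close0 (x y K : R) (f g : R -> R) :
  (forall e, 0 < e -> exists r, [/\ 0 < r <= 1, `|f r - x| < e & `|g r - y| < e]) ->
  (forall r, 0 < r <= 1 -> `|f r - g r| <= K) -> `|x - y| <= K.
Proof.
move=> H fgK; apply/ler_addgt0Pl => e e0.
have e20 : 0 < e / 2 by rewrite divr_gt0.
have [r [r01 fx gy]] := H _ e20.
have := fgK _ r01.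
by move: fx gy; rewrite !ltr_norml !ler_norml; lra.
Qed.

Lemma fdist_le u v K :
  (forall r, 0 < r <= 1 -> `|level_inf u r - level_inf v r| <= K) ->
  (forall r, 0 < r <= 1 -> `|level_sup u r - level_sup v r| <= K) ->
  fdist u v <= K.
Proof.
move=> H1 H2; apply: ge_sup; first exact: (S_has_sup u v).1.
move=> z [r /=]; rewrite in_itv/= => /andP[r0 r1] <-.
move: r0; rewrite le_eqVlt => /orP[/eqP<-|r0]; last first.
  by rewrite ge_max H1 ?H2// r0.
rewrite ge_max; apply/andP; split.
- apply: (close0 _ H1) => e e0.
  have [|s /andP[s0 s1] sc] := @level_inf_right0 _ u (level_inf u 0 + e); first lra.
  have [|t /andP[t0 t1] tc] := @level_inf_right0 _ v (level_inf v 0 + e); first lra.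
  have [st|ts] := leP s t.
    exists s; rewrite s0 s1; split => //; rewrite ltr_norml.
      have := level_inf_nd u (ltW s0) s1; lra.
    have := level_inf_nd v (ltW s0) s1; have := level_inf_nd v st t1; lra.
  exists t; rewrite t0 t1; split => //; rewrite ltr_norml.
    have := level_inf_nd u (ltW t0) t1; have := level_inf_nd u (ltW ts) s1; lra.
  have := level_inf_nd v (ltW t0) t1; lra.
- apply: (close0 _ H2) => e e0.
  have [|s /andP[s0 s1] sc] := @level_sup_right0 _ u (level_sup u 0 - e); first lra.
  have [|t /andP[t0 t1] tc] := @level_sup_right0 _ v (level_sup v 0 - e); first lra.
  have [st|ts] := leP s t.
    exists s; rewrite s0 s1; split => //; rewrite ltr_norml.
      have := level_sup_ni u (ltW s0) s1; lra.
    have := level_sup_ni v (ltW s0) s1; have := level_sup_ni v st t1; lra.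
  exists t; rewrite t0 t1; split => //; rewrite ltr_norml.
    have := level_sup_ni u (ltW t0) t1; have := level_sup_ni u (ltW ts) s1; lra.
  have := level_sup_ni v (ltW t0) t1; lra.
Qed.

Let itvW (r : R) : 0 < r <= 1 -> 0 <= r <= 1.
Proof. by move=> /andP[/ltW -> ->]. Qed.

Let fdistxx u : fdist u u = 0.
Proof.
apply/le_anti/andP; split.
  by apply: fdist_le => r _; rewrite subrr normr0.
by rewrite (le_trans _ (level_inf_dist u u (r := 0) _))// lexx ler01.
Qed.

Let fdist_positivity u v : fdist u v = 0 -> u = v.
Proof.
move=> uv; have E r : 0 < r <= 1 ->
    level_inf u r = level_inf v r /\ level_sup u r = level_sup v r.
  move=> /itvW r01.
  have := level_inf_dist u v r01; have := level_sup_dist u v r01.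
  by rewrite uv !normr_le0 !subr_eq0 => /eqP-> /eqP->.
have L (u1 u2 : fuzzy R) x : (forall r, 0 < r <= 1 ->
    level_inf u1 r = level_inf u2 r /\ level_sup u1 r = level_sup u2 r) ->
    u1 x <= u2 x.
  move=> E12; have [u0|u0] := leP (u1 x) 0.
    by rewrite (le_trans u0)//; case/andP: (fuzzy_itv01 (fuzzyP u2) x).
  have u01 : 0 < u1 x <= 1.
    by rewrite u0; case/andP: (fuzzy_itv01 (fuzzyP u1) x).
  have [e1 e2] := E12 _ u01.
  by rewrite le_fuzzyE// -e1 -e2 -le_fuzzyE.
apply: fuzzy_eqP => x; apply/le_anti; rewrite !L// => r r01.
by have [-> ->] := E r r01.
Qed.

Let fdist_sym u v : fdist u v = fdist v u.
Proof.
by apply/le_anti/andP; split; apply: fdist_le => r /itvW r01;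
  rewrite distrC; (exact: level_inf_dist || exact: level_sup_dist).
Qed.

Let fdist_triangle v u w : fdist u w <= fdist u v + fdist v w.
Proof.
apply: fdist_le => r /itvW r01.
  rewrite (le_trans (ler_distD (level_inf v r) _ _))//.
  by apply: lerD; exact: level_inf_dist.
rewrite (le_trans (ler_distD (level_sup v r) _ _))//.
by apply: lerD; exact: level_sup_dist.
Qed.

HB.instance Definition _ := isMetric.Build R (fuzzy R)
  fdistxx fdist_positivity fdist_sym fdist_triangle.

Lemma fdist_fadd (u u' v v' : fuzzy R) :
  fdist (fadd u v) (fadd u' v') <= fdist u u' + fdist v v'.
Proof.
apply: fdist_le => r r01; rewrite ?(level_fadd _ _ r01).1 ?(level_fadd _ _ r01).2.
  rewrite opprD addrACA (le_trans (ler_normD _ _))//.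
  by apply: lerD; apply: level_inf_dist; exact: itvW.
rewrite opprD addrACA (le_trans (ler_normD _ _))//.
by apply: lerD; apply: level_sup_dist; exact: itvW.
Qed.

Let minmax_dist (x y x' y' K : R) : `|x - x'| <= K -> `|y - y'| <= K ->
  `|Num.min x y - Num.min x' y'| <= K /\ `|Num.max x y - Num.max x' y'| <= K.
Proof.
rewrite !ler_norml => /andP[? ?] /andP[? ?].
have [?|?] := leP x y; have [?|?] := leP x' y'; split; lra.
Qed.

Lemma fdist_fscale (a : R) u v :
  fdist (fscale a u) (fscale a v) <= `|a| * fdist u v.
Proof.
have H r : 0 < r <= 1 ->
  `|a * level_inf u r - a * level_inf v r| <= `|a| * fdist u v /\
  `|a * level_sup u r - a * level_sup v r| <= `|a| * fdist u v.
  move=> /itvW r01; rewrite -!mulrBr !normrM !ler_wpM2l//.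
    exact: level_sup_dist.
  exact: level_inf_dist.
apply: fdist_le => r r01; rewrite ?(level_fscale _ _ r01).1 ?(level_fscale _ _ r01).2.
  exact: (minmax_dist (H r r01).1 (H r r01).2).1.
exact: (minmax_dist (H r r01).1 (H r r01).2).2.
Qed.

End FuzzyMetric.

Notation itv_type a b := (set_type `[a, b]%classic).

Section Cbar.
Variable R : realType.
Local Notation I01 := (itv_type (0 : R) 1).

Definition left_nbhs (r : I01) : set_system I01 :=
  within [set s : I01 | \val s < \val r] (nbhs r).
Definition right_nbhs (r : I01) : set_system I01 :=
  within [set s : I01 | \val r < \val s] (nbhs r).

#[global] Instance left_nbhs_filter r : Filter (left_nbhs r).
Proof. exact: within_filter. Qed.
#[global] Instance right_nbhs_filter r : Filter (right_nbhs r).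
Proof. exact: within_filter. Qed.

Record is_Cbar (f : I01 -> R) : Prop := IsCbar {
  Cbar_bounded : bounded_fun f;
  Cbar_left_continuous : forall r, 0 < \val r -> f s @[s --> left_nbhs r] --> f r;
  Cbar_right_limit : forall r, \val r < 1 -> cvg (f s @[s --> right_nbhs r]);
  Cbar_right_continuous0 :
    forall r, \val r = 0 -> f s @[s --> right_nbhs r] --> f r
}.

Definition Cbar_pred : {pred I01 -> R} := [pred f | `[< is_Cbar f >]].

Record Cbar := MkCbar { Cbar_fun :> I01 -> R ; _ : Cbar_fun \in Cbar_pred }.

HB.instance Definition _ := [isSub for Cbar_fun].
HB.instance Definition _ := [Choice of Cbar by <:].

Lemma CbarP (f : Cbar) : is_Cbar f.
Proof. by case: f => f /= /asboolP. Qed.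

Lemma Cbar_submod_closed : submod_closed Cbar_pred.
Proof.
split.
  apply/asboolP; split.
  - exists 0; split => // M M0 x _ /=; rewrite normr0; exact: ltW.
  - by move=> r _; exact: cvg_cst.
  - by move=> r _; exact: is_cvg_cst.
  - by move=> r _; exact: cvg_cst.
move=> a f g /asboolP fP /asboolP gP; apply/asboolP; split.
- have [M [Mr HM]] := Cbar_bounded fP; have [N [Nr HN]] := Cbar_bounded gP.
  exists (`|a| * (M + 1) + (N + 1)); split; first exact: num_real.
  move=> K KM x _ /=.
  rewrite (le_trans (ler_normD _ _))// (le_trans _ (ltW KM))// lerD//.
    by rewrite normrM ler_wpM2l// HM// ltrDl.
  by rewrite HN// ltrDl.
- move=> r r0; apply: cvgD; last exact: Cbar_left_continuous.
  by apply: cvgMr; exact: Cbar_left_continuous.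
- move=> r r1; apply: is_cvgD; last exact: Cbar_right_limit.
  by apply: is_cvgMr; exact: Cbar_right_limit.
- move=> r r0; apply: cvgD; last exact: Cbar_right_continuous0.
  by apply: cvgMr; exact: Cbar_right_continuous0.
Qed.

HB.instance Definition _ :=
  GRing.isSubmodClosed.Build R (I01 -> R) Cbar_pred Cbar_submod_closed.
HB.instance Definition _ := [SubChoice_isSubLmodule of Cbar by <:].

End Cbar.

Section CbarNorm.
Variable R : realType.
Local Notation I01 := (itv_type (0 : R) 1).
Local Notation Cbar := (Cbar R).

Definition Cbar_norm (f : Cbar) : R := sup (range (fun r : I01 => `|f r|)).

Let i0 : I01.
Proof. by exists 0; apply/mem_set; rewrite /= in_itv/= lexx ler01. Defined.

Let norm_has_sup (f : Cbar) : has_sup (range (fun r : I01 => `|f r|)).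
Proof.
split; first by exists `|f i0|; exists i0.
have [M [Mr HM]] := Cbar_bounded (CbarP f).
by exists (M + 1) => _ [r _ <-]; apply: HM => //; rewrite ltrDl.
Qed.

Lemma le_Cbar_norm (f : Cbar) r : `|f r| <= Cbar_norm f.
Proof. by apply: ub_le_sup; [exact: (norm_has_sup f).2|exists r]. Qed.

Lemma Cbar_norm_le (f : Cbar) K : (forall r, `|f r| <= K) -> Cbar_norm f <= K.
Proof.
move=> fK; apply: ge_sup; first exact: (norm_has_sup f).1.
by move=> _ [r _ <-].
Qed.

Let normD (f g : Cbar) : Cbar_norm (f + g) <= Cbar_norm f + Cbar_norm g.
Proof.
apply: Cbar_norm_le => r; rewrite (le_trans (ler_normD _ _))//.
by apply: lerD; exact: le_Cbar_norm.
Qed.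

Let norm_ge0 (f : Cbar) : 0 <= Cbar_norm f.
Proof. exact: le_trans (le_Cbar_norm f i0). Qed.

Let normZ_le (a : R) (f : Cbar) : Cbar_norm (a *: f) <= `|a| * Cbar_norm f.
Proof.
by apply: Cbar_norm_le => r; rewrite normrM ler_wpM2l//; exact: le_Cbar_norm.
Qed.

Let normZ (a : R) (f : Cbar) : Cbar_norm (a *: f) = `|a| * Cbar_norm f.
Proof.
apply/le_anti; rewrite normZ_le/=.
have [->|a0] := eqVneq a 0; first by rewrite normr0 mul0r norm_ge0.
rewrite -{1}[f](scalerK a0) -ler_pdivlMl ?normr_gt0// -normfV.
exact: normZ_le.
Qed.

Let norm_eq0 (f : Cbar) : Cbar_norm f = 0 -> f = 0.
Proof.
move=> f0; apply: val_inj; apply/funext => r.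
by apply/eqP; rewrite -normr_le0 (le_trans (le_Cbar_norm f r))// f0.
Qed.

HB.instance Definition _ :=
  Lmodule_isNormed.Build R Cbar normD normZ norm_eq0.

Let mdist_ge0 (f g : Cbar) : 0 <= `|f - g|.
Proof. exact: normr_ge0. Qed.
Let mdist_pos (f g : Cbar) : `|f - g| = 0 -> f = g.
Proof. by move/normr0_eq0/eqP; rewrite subr_eq0 => /eqP. Qed.
Let ballE (f : Cbar) d : ball f d = [set g | `|f - g| < d].
Proof. by []. Qed.

HB.instance Definition _ :=
  @PseudoMetric_isMetric.Build R Cbar (fun f g => `|f - g|)
    mdist_ge0 mdist_pos ballE.

End CbarNorm.

Section Cab.
Variables (R : realType) (a b : R).

(* C([a, b]; M), where [a, b] carries the subspace topology; the distance is
   the uniform one, i.e. D^* for M = fuzzy R and Delta for M = Cbar R. *)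
Definition Cab (M : metricType R) : Type := continuousType (itv_type a b) M.

Section Metric.
Variable M : metricType R.
Local Notation C := (Cab M).

HB.instance Definition _ := Choice.on C.

Lemma Cab_cvg (f : C) t : f s @[s --> t] --> f t.
Proof. exact: cts_fun. Qed.

Lemma Cab_eqP (f g : C) : f =1 g -> f = g.
Proof. by move=> fg; apply/continuousEP. Qed.

Definition mk_Cab (f : itv_type a b -> M) (cf : continuous f) : C :=
  [the continuousType _ _ of mkcts cf].

Definition Cab_dist (f g : C) : R :=
  sup (range (fun t : itv_type a b => mdist (f t) (g t))).

Import metricType_numDomainType.

Lemma Cab_near (f : C) t e : 0 < e ->
  \forall s \near t, mdist (f t) (f s) < e.
Proof.
by move=> e0; apply: ((@cvgrPdist_lt _ M _ (nbhs t) _ f (f t)).1 (@Cab_cvg f t)) e0.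
Qed.

Lemma mk_Cab_near (f : itv_type a b -> M) :
  (forall t e, 0 < e -> \forall s \near t, mdist (f t) (f s) < e) ->
  continuous f.
Proof. by move=> H t; apply/(@cvgrPdist_lt _ M _ (nbhs t)) => e; exact: H. Qed.

Let h (f g : C) t := mdist (f t) (g t).

Let h_cont f g : continuous (h f g).
Proof.
move=> t; apply/(@cvgrPdist_lt _ R^o _ (nbhs t)) => e e0.
have e20 : 0 < e / 2 by rewrite divr_gt0.
have Hf := Cab_near f t e20.
have Hg := Cab_near g t e20.
near=> s.
have fs : mdist (f t) (f s) < e / 2 by near: s.
have gs : mdist (g t) (g s) < e / 2 by near: s.
have := metric_triangle (f t) (f s) (g t).
have := metric_triangle (f s) (g s) (g t).
have := metric_triangle (f s) (f t) (g s).
have := metric_triangle (f t) (g t) (g s).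
rewrite (metric_sym (f s) (f t)) (metric_sym (g s) (g t)) /h => ? ? ? ?.
change (`|mdist (f s) (g s) - mdist (f t) (g t)| < e).
by rewrite ltr_norml; lra.
Unshelve. all: by end_near. Qed.

Let h_bounded f g : exists K, forall t, h f g t <= K.
Proof.
have [[t0]|no] := pselect (exists t : itv_type a b, True); last first.
  by exists 0 => t; exfalso; apply: no; exists t.
have ab0 : `[a, b]%classic !=set0 by exists (\val t0); exact: set_valP.
have cf := (@subspace_valL_continuousP' _ `[a, b]%classic _ 0 (h f g)).2 (@h_cont f g).
have [c cab cmax] := compact_EVT_max ab0 (@segment_compact _ a b) cf.
exists (valL_ 0 (h f g) c) => t.
have E := congr1 (@^~ t) (@valLK _ _ 0 `[a, b]%classic (h f g)).
by rewrite -[leLHS]E; exact: cmax (valP t).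
Qed.

Lemma le_Cab_dist (f g : C) t : mdist (f t) (g t) <= Cab_dist f g.
Proof.
have [K HK] := h_bounded f g; apply: ub_le_sup; last by exists t.
by exists K => _ [s _ <-]; exact: HK.
Qed.

Lemma Cab_dist_le (f g : C) K : 0 <= K -> (forall t, mdist (f t) (g t) <= K) ->
  Cab_dist f g <= K.
Proof.
move=> K0 H; rewrite /Cab_dist; set A := (X in sup X).
have [->|/set0P A0] := eqVneq A set0; first by rewrite sup0.
by apply: ge_sup => // _ [t _ <-].
Qed.

Lemma Cab_dist_ge0 f g : 0 <= Cab_dist f g.
Proof.
rewrite /Cab_dist; set A := (X in sup X).
have [->|/set0P[_ [t _ _]]] := eqVneq A set0; first by rewrite sup0.
exact: le_trans (mdist_ge0 _ _) (le_Cab_dist f g t).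
Qed.

Let distxx f : Cab_dist f f = 0.
Proof.
apply/le_anti; rewrite Cab_dist_ge0 andbT.
by apply: Cab_dist_le => // t; rewrite mdistxx.
Qed.

Let dist_pos f g : Cab_dist f g = 0 -> f = g.
Proof.
move=> fg; apply: Cab_eqP => t; apply: mdist_positivity.
by apply/le_anti; rewrite mdist_ge0 -fg le_Cab_dist.
Qed.

Let dist_sym f g : Cab_dist f g = Cab_dist g f.
Proof.
by apply/le_anti/andP; split; apply: Cab_dist_le (Cab_dist_ge0 _ _) _ => t;
  rewrite metric_sym; exact: le_Cab_dist.
Qed.

Let dist_triangle g f k : Cab_dist f k <= Cab_dist f g + Cab_dist g k.
Proof.
apply: Cab_dist_le; first by rewrite addr_ge0// Cab_dist_ge0.
move=> t; rewrite (le_trans (metric_triangle _ (g t) _))//.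
by apply: lerD; exact: le_Cab_dist.
Qed.

HB.instance Definition _ := isMetric.Build R C
  distxx dist_pos dist_sym dist_triangle.

End Metric.

Section Vector.
Local Notation C := (Cab (Cbar R)).
Implicit Types F G : C.

Let add_cont F G : continuous (fun t => F t + G t).
Proof. by move=> t; exact: cvgD (@Cab_cvg _ F t) (@Cab_cvg _ G t). Qed.
Let opp_cont F : continuous (fun t => - F t).
Proof. by move=> t; exact: cvgN (@Cab_cvg _ F t). Qed.
Let scale_cont (k : R) F : continuous (fun t => k *: F t).
Proof. by move=> t; exact: cvgZr (@Cab_cvg _ F t). Qed.
Let zero_cont : continuous (fun _ : itv_type a b => 0 : Cbar R).
Proof. by move=> t; apply: (@cvg_cst _ (0 : Cbar R) _ (nbhs t)). Qed.

Definition Cab_add F G : C := mk_Cab (@add_cont F G).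
Definition Cab_opp F : C := mk_Cab (@opp_cont F).
Definition Cab_scale k F : C := mk_Cab (@scale_cont k F).
Definition Cab_zero : C := mk_Cab zero_cont.

Let addA : associative Cab_add.
Proof. by move=> F G H; apply: Cab_eqP => t; exact: addrA. Qed.
Let addC : commutative Cab_add.
Proof. by move=> F G; apply: Cab_eqP => t; exact: addrC. Qed.
Let add0 : left_id Cab_zero Cab_add.
Proof. by move=> F; apply: Cab_eqP => t; exact: add0r. Qed.
Let addN : left_inverse Cab_zero Cab_opp Cab_add.
Proof. by move=> F; apply: Cab_eqP => t; exact: addNr. Qed.

HB.instance Definition _ := GRing.isZmodule.Build C addA addC add0 addN.

Let scaleA k l F : Cab_scale k (Cab_scale l F) = Cab_scale (k * l) F.
Proof. by apply: Cab_eqP => t; exact: scalerA. Qed.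
Let scale1 : left_id 1 Cab_scale.
Proof. by move=> F; apply: Cab_eqP => t; exact: scale1r. Qed.
Let scaleDr : right_distributive Cab_scale +%R.
Proof. by move=> k F G; apply: Cab_eqP => t; exact: scalerDr. Qed.
Let scaleDl F : {morph Cab_scale^~ F : k l / k + l}.
Proof. by move=> k l; apply: Cab_eqP => t; exact: scalerDl. Qed.

HB.instance Definition _ :=
  GRing.Zmodule_isLmodule.Build R C scaleA scale1 scaleDr scaleDl.

End Vector.

Section Fuzzy.
Local Notation C := (Cab (fuzzy R)).
Import metricType_numDomainType.
Implicit Types x y : C.

Let fadd_cont x y : continuous (fun t => fadd (x t) (y t)).
Proof.
apply: mk_Cab_near => t e e0.
have e20 : 0 < e / 2 by rewrite divr_gt0.
have Hx := Cab_near x t e20.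
have Hy := Cab_near y t e20.
near=> s.
rewrite (le_lt_trans (fdist_fadd _ _ _ _))// [e]splitr ltrD//; by near: s.
Unshelve. all: by end_near. Qed.

Let fscale_cont (k : R) x : continuous (fun t => fscale k (x t)).
Proof.
apply: mk_Cab_near => t e e0.
have k0 : 0 < `|k| + 1 by rewrite ltr_wpDl.
have ek0 : 0 < e / (`|k| + 1) by rewrite divr_gt0.
have Hx := Cab_near x t ek0.
apply: filterS Hx => s; rewrite ltr_pdivlMr// mulrC => /(le_lt_trans _); apply.
rewrite (le_trans (fdist_fscale _ _ _))// ler_wpM2r//.
  exact: (mdist_ge0 (x t) (x s)).
by rewrite lerDl.
Qed.

Definition Cab_fadd x y : C := mk_Cab (@fadd_cont x y).
Definition Cab_fscale k x : C := mk_Cab (@fscale_cont k x).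

End Fuzzy.
End Cab.

Section LevelFunctions.
Variable R : realType.
Local Notation I01 := (itv_type (0 : R) 1).

Lemma I01P (r : I01) : 0 <= \val r <= 1.
Proof. by have /= := set_valP r; rewrite in_itv. Qed.

Section Monotone.
Variable g : R -> R.
Hypothesis g_nd : forall r s, 0 <= r -> r <= s -> s <= 1 -> g r <= g s.
Hypothesis g_left : forall r c, 0 < r <= 1 -> c < g r ->
  exists2 s, 0 < s < r & c < g s.
Hypothesis g_right0 : forall c, g 0 < c -> exists2 s, 0 < s <= 1 & g s < c.

Let near_gt (r : I01) s0 : s0 < \val r -> \forall s \near r, s0 < \val s.
Proof.
move=> H; have /= := @initial_continuous _ _ (set_val : I01 -> R) r _ (lt_nbhsr H).
exact.
Qed.

Let near_lt (r : I01) s0 : \val r < s0 -> \forall s \near r, \val s < s0.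
Proof.
move=> H; have /= := @initial_continuous _ _ (set_val : I01 -> R) r _ (lt_nbhsl H).
exact.
Qed.

Lemma is_Cbar_nondecreasing : is_Cbar (fun r : I01 => g (\val r)).
Proof.
have gb r : 0 <= r <= 1 -> g 0 <= g r <= g 1.
  by move=> /andP[r0 r1]; rewrite !g_nd.
split.
- exists (`|g 0| + `|g 1|); split; first exact: num_real.
  move=> M HM r _ /=; have := gb _ (I01P r).
  have := ler_norm (g 1); have := ler_norm (- g 0); rewrite normrN.
  have := normr_ge0 (g 0); have := normr_ge0 (g 1).
  by rewrite ler_norml; lra.
- move=> r r0; have /andP[_ r1] := I01P r.
  apply/(@cvgrPdist_lt _ R _ (left_nbhs r)) => e e0.
  have r01 : 0 < \val r <= 1 by rewrite r0.
  have [|s0 /andP[s00 s0r] s0e] := @g_left (\val r) (g (\val r) - e) r01; first lra.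
  apply: filterS (near_gt s0r) => s s0s /= sr.
  have := g_nd (ltW s00) (ltW s0s) (le_trans (ltW sr) r1).
  have /andP[sge0 _] := I01P s.
  have := g_nd sge0 (ltW sr) r1.
  by rewrite ltr_norml; lra.
- move=> r r1; pose A := [set g s | s in [set s | \val r < s <= 1]].
  have /andP[r0 _] := I01P r.
  have Al : lbound A (g (\val r)).
    by move=> _ [s /= /andP[rs s1] <-]; apply: g_nd => //; exact: ltW.
  have iA : has_inf A.
    by split; [exists (g 1); exists 1 => //=; rewrite r1 lexx|exists (g (\val r))].
  apply/cvg_ex; exists (inf A).
  apply/(@cvgrPdist_lt _ R _ (right_nbhs r)) => e e0.
  have [_ [s1 /= /andP[rs1 s11] <-] s1e] := inf_adherent e0 iA.
  apply: filterS (near_lt rs1) => s ss1 /= rs.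
  have /andP[sge0 sle1] := I01P s.
  have : inf A <= g (\val s).
    by apply: ge_inf; [exact: iA.2|exists (\val s); rewrite //= rs].
  have := g_nd sge0 (ltW ss1) s11.
  by rewrite ltr_norml; lra.
- move=> r r0; apply/(@cvgrPdist_lt _ R _ (right_nbhs r)) => e e0; rewrite r0.
  have [|s1 /andP[s10 s11] s1e] := @g_right0 (g 0 + e); first lra.
  have rs1 : \val r < s1 by rewrite r0.
  apply: filterS (near_lt rs1) => s ss1 /= rs.
  have /andP[sge0 sle1] := I01P s.
  have := g_nd sge0 (ltW ss1) s11.
  have := g_nd (lexx 0) sge0 sle1.
  by rewrite ltr_norml; lra.
Qed.

End Monotone.

Variable u : fuzzy R.

Lemma level_inf_is_Cbar : (fun r : I01 => level_inf u (\val r)) \in @Cbar_pred R.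
Proof.
apply/asboolP/(@is_Cbar_nondecreasing (level_inf u)).
- by move=> r s _; exact: level_inf_nd.
- exact: (level_inf_left (u := u)).
- exact: (level_inf_right0 (u := u)).
Qed.

Lemma level_sup_is_Cbar : (fun r : I01 => level_sup u (\val r)) \in @Cbar_pred R.
Proof.
have : (fun r : I01 => - level_sup u (\val r)) \in @Cbar_pred R.
  apply/asboolP/(@is_Cbar_nondecreasing (fun r => - level_sup u r)).
  - by move=> r s _ rs s1; rewrite lerN2; exact: level_sup_ni.
  - move=> r c r01; rewrite ltrNr => /(level_sup_left r01)[s ? ?].
    by exists s => //; rewrite ltrNr.
  - move=> c; rewrite ltrNl => /level_sup_right0[s ? ?].
    by exists s => //; rewrite ltrNl.
move=> lP; rewrite (_ : (fun _ => _) = \val (- MkCbar lP)); first exact: valP.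
by apply/funext => r; rewrite /= /GRing.opp/= opprK.
Qed.

Definition fuzzy_minus : Cbar R := MkCbar level_inf_is_Cbar.
Definition fuzzy_plus : Cbar R := MkCbar level_sup_is_Cbar.

End LevelFunctions.

Section Functionals.
Variables (R : realType) (a b : R).
Implicit Types x : Cab a b (fuzzy R).

Lemma fuzzy_minus_dist (u v : fuzzy R) :
  `|fuzzy_minus u - fuzzy_minus v| <= fdist u v.
Proof. by apply: Cbar_norm_le => r; apply: level_inf_dist; exact: I01P. Qed.

Lemma fuzzy_plus_dist (u v : fuzzy R) :
  `|fuzzy_plus u - fuzzy_plus v| <= fdist u v.
Proof. by apply: Cbar_norm_le => r; apply: level_sup_dist; exact: I01P. Qed.

Let minus_cont x : continuous (fun t => fuzzy_minus (x t)).
Proof.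
apply: mk_Cab_near => t e e0; apply: filterS (Cab_near x t e0) => s.
exact: le_lt_trans (fuzzy_minus_dist _ _).
Qed.

Let plus_cont x : continuous (fun t => fuzzy_plus (x t)).
Proof.
apply: mk_Cab_near => t e e0; apply: filterS (Cab_near x t e0) => s.
exact: le_lt_trans (fuzzy_plus_dist _ _).
Qed.

Definition Cab_minus x : Cab a b (Cbar R) := mk_Cab (@minus_cont x).
Definition Cab_plus x : Cab a b (Cbar R) := mk_Cab (@plus_cont x).

Definition fuzzy_linear (A : Cab a b (fuzzy R) -> R) : Prop :=
  (forall x y, A (Cab_fadd x y) = A x + A y) /\
  (forall (k : R) x, A (Cab_fscale k x) = k * A x).

Definition IC : set (Cbar R) :=
  [set f | forall r s, \val r <= \val s -> f r <= f s].

Definition CIC : set (Cab a b (Cbar R)) := [set F | forall t, IC (F t)].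

End Functionals.

(* Main.v *)
(* If x_- + x_+ = 0 then (-1) x = x, so a linear x^* vanishes at x; hence
   x_- + x_+ |-> x^*(x) is a well-defined linear functional on the subspace of
   all the sums x_- + x_+, and a Hamel-type extension gives L.  An F in CIC is
   itself such a sum, with x_- = F - F(1)/2 and x_+ = F(1)/2, and this x depends
   on F in a Lipschitz way, whence the continuity of L on CIC.  Conversely
   x^*(x) = L(x_-) - L(- x_+), where both x_- and - x_+ belong to CIC. *)
From HB Require Import structures.
Require Import Defs.
From mathcomp Require Import all_boot all_order all_algebra.
From mathcomp Require Import all_classical all_reals topology normedtype.
From mathcomp Require Import ring lra.
Import Order.TTheory GRing.Theory Num.Theory.
Import numFieldNormedType.Exports.
Local Open Scope classical_set_scope.
Local Open Scope ring_scope.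

(** * Extending partial linear functionals, represented by their graphs *)

(** The graph of a linear functional on a subspace of [V]. Uniqueness of the value is asked at 0
    only; subtracting two pairs over the same vector gives it everywhere. *)
Record linear_graph {K : fieldType} {V : lmodType K} (G : set (V * K)) : Prop :=
  LinearGraph {
    linear_graph0 : G (0, 0);
    linear_graphP : forall k u v r s,
      G (u, r) -> G (v, s) -> G (k *: u + v, k * r + s);
    linear_graph_fun : forall r, G (0, r) -> r = 0
  }.

Lemma linear_graph_eq {K : fieldType} {V : lmodType K} (G : set (V * K)) :
  linear_graph G -> forall v r s, G (v, r) -> G (v, s) -> r = s.
Proof.
move=> gG v r s Gr Gs; have := linear_graphP _ gG (-1) _ _ _ _ Gs Gr.
rewrite scaleN1r addNr mulN1r addrC => /(linear_graph_fun _ gG)/eqP.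
by rewrite subr_eq0 => /eqP.
Qed.

(* Zorn is applied to the sets X with [X `|` G] a linear graph rather than to
   the linear graphs containing G, so that the empty chain has a bound. *)
Lemma linear_graph_maximal {K : fieldType} {V : lmodType K} (G : set (V * K)) :
  linear_graph G -> exists2 B : set (V * K), linear_graph B /\ G `<=` B &
    forall C, linear_graph C -> B `<=` C -> C `<=` B.
Proof.
move=> gG; pose P (X : set (V * K)) := linear_graph (X `|` G).
have [|A [PA maxA]] := @Zorn_bigcup _ P.
  move=> F FP totF; have FG X p : F X -> (X `|` G) p ->
      ((\bigcup_(X in F) X) `|` G) p.
    by move=> FX [Xp|Gp]; [left; exists X|right].
  split; first by right; exact: linear_graph0.
  - move=> k u v r s [[X FX Xu]|Gu] [[Y FY Yv]|Gv].
    + have [XY|YX] := totF _ _ FX FY.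
      * apply: (FG Y _ FY); apply: (linear_graphP _ (FP _ FY)).
          by left; exact: XY.
        by left.
      * apply: (FG X _ FX); apply: (linear_graphP _ (FP _ FX)).
          by left.
        by left; exact: YX.
    + by apply: (FG X _ FX); apply: (linear_graphP _ (FP _ FX)); [left|right].
    + by apply: (FG Y _ FY); apply: (linear_graphP _ (FP _ FY)); [right|left].
    + by right; exact: linear_graphP.
  - move=> r [[X FX Xr]|]; last exact: linear_graph_fun.
    by apply: (linear_graph_fun _ (FP _ FX)); left.
exists (A `|` G); first by split => //; exact: subsetUr.
move=> C gC AGC p Cp; left; apply: contrapT => nAp.
apply: (maxA C).
  rewrite properEneq; split; first by apply/eqP => eAC; apply: nAp; rewrite eAC.
  by move=> q Aq; apply: AGC; left.
rewrite /P; suff -> : C `|` G = C by [].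
by apply/setUidPl => q Gq; apply: AGC; right.
Qed.

(** The domain gains the line through [v], on which the extended functional is 0. This is consistent
    because [v] lies outside the old domain. *)
Lemma linear_graph_extend {K : fieldType} {V : lmodType K} (B : set (V * K)) v :
  linear_graph B -> (forall r, ~ B (v, r)) ->
  linear_graph [set p | exists u k, B (u, p.2) /\ p.1 = u + k *: v].
Proof.
move=> gB nBv; split.
- by exists 0, 0; rewrite scale0r addr0; split => //; exact: linear_graph0.
- move=> k _ _ r s [u [i [/= Bu ->]]] [w [j [/= Bw ->]]].
  exists (k *: u + w), (k * i + j); split; first exact: linear_graphP.
  by rewrite /= scalerDr scalerDl scalerA addrACA.
- move=> r [u [k [/= Bu uk0]]].
  have k0 : k = 0.
    (* If [k] were nonzero, then [v = - k^-1 *: u] would already be in the domain of [B]. *)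
    apply: contrapT => /eqP k0; apply: (nBv (- k^-1 * r)).
    have := linear_graphP _ gB (- k^-1) _ _ _ _ Bu (linear_graph0 _ gB).
    rewrite !addr0; suff -> : - k^-1 *: u = v by [].
    have -> : u = - (k *: v) by apply/eqP; rewrite -addr_eq0 -uk0.
    by rewrite scalerN scaleNr opprK scalerA mulVf// scale1r.
  apply: (linear_graph_fun _ gB); move: uk0 Bu.
  by rewrite k0 scale0r addr0 => <-.
Qed.

(** A maximal linear graph has full domain, since a missing vector [v] could be adjoined with value
    0. Choosing values then yields the functional. *)
Lemma linear_graph_total {K : fieldType} {V : lmodType K} (G : set (V * K)) :
  linear_graph G ->
  exists L : {scalar V}, forall v r, G (v, r) -> L v = r.
Proof.
move=> /linear_graph_maximal[B [gB GB] maxB].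
have totB v : exists r, B (v, r).
  apply: contrapT => /forallNP nBv.
  apply: (nBv 0); apply: maxB (linear_graph_extend _ v gB nBv) _ (v, 0) _.
    by move=> [u r] Bu; exists u, 0; rewrite scale0r addr0.
  by exists 0, 1; rewrite add0r scale1r; split => //; exact: linear_graph0.
have [f Bf] := choice totB.
have lf : linear_for *%R f.
  move=> k u v; apply: (linear_graph_eq _ gB _ _ _ (Bf _)).
  exact: linear_graphP.
pose fL := GRing.isLinear.Build _ _ _ _ f lf.
pose L : {scalar V} := HB.pack f fL.
exists L => v r /GB; exact: (linear_graph_eq _ gB _ _ _ (Bf v)).
Qed.

(** * One-sided limits on the unit interval *)

Section UnitInterval.
Context {R : realType}.
Local Notation I01 := (itv_type (0 : R) 1).

Lemma clamp_subproof (r : R) : Num.max 0 (Num.min 1 r) \in `[0, 1]%classic.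
Proof. by apply/mem_set; rewrite /= in_itv/= le_max lexx ge_max ler01 ge_min lexx. Qed.

(** The retraction of the real line onto [0, 1], used to carry one-sided filters of [R] over to the
    subtype. *)
Definition clamp (r : R) : I01 := SigSub (clamp_subproof r).

Lemma clampE r : 0 <= r <= 1 -> \val (clamp r) = r.
Proof. by move=> /andP[r0 r1] /=; rewrite min_r// max_r. Qed.

Lemma clampK (r : I01) : clamp (\val r) = r.
Proof. by apply: val_inj; rewrite clampE// I01P. Qed.

Lemma clamp_continuous : continuous clamp.
Proof.
apply: continuous_comp_initial => r.
apply: (@continuous_max R R^o (cst 0) (Num.min 1)); first exact: cvg_cst.
by apply: (@continuous_min R R^o (cst 1) id); [exact: cvg_cst|exact: cvg_id].
Qed.

(** This is properness of [left_nbhs r]: [clamp] is continuous and fixes [r], so it transports the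
    proper left filter of [R] at [r]. *)
Lemma left_nbhs_ex (r : I01) (P : I01 -> Prop) : 0 < \val r ->
  (\forall s \near left_nbhs r, P s) -> exists2 s, \val s < \val r & P s.
Proof.
move=> r0; rewrite /left_nbhs near_withinE => H.
have H' : \forall t \near (\val r)^'-,
    \val (clamp t) < \val r -> P (clamp t).
  have C := cvg_at_left_filter (@clamp_continuous (\val r)).
  by rewrite clampK in C; exact: C _ H.
near (\val r)^'- => t.
have Pt : \val (clamp t) < \val r -> P (clamp t) by near: t; exact: H'.
have t0 : 0 < t by near: t; exact: nbhs_left_gt.
have tr : t < \val r by near: t; exact: nbhs_left_lt.
have /andP[_ r1] := I01P r.
have tE : \val (clamp t) = t by rewrite clampE// (ltW t0) (le_trans (ltW tr)).
by exists (clamp t); rewrite ?tE//; apply: Pt; rewrite tE.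
Unshelve. all: by end_near. Qed.

Lemma right_nbhs_ex (r : I01) (P : I01 -> Prop) : \val r < 1 ->
  (\forall s \near right_nbhs r, P s) -> exists2 s, \val r < \val s & P s.
Proof.
move=> r1; rewrite /right_nbhs near_withinE => H.
have H' : \forall t \near (\val r)^'+,
    \val r < \val (clamp t) -> P (clamp t).
  have C := cvg_at_right_filter (@clamp_continuous (\val r)).
  by rewrite clampK in C; exact: C _ H.
near (\val r)^'+ => t.
have Pt : \val r < \val (clamp t) -> P (clamp t) by near: t; exact: H'.
have t1 : t < 1 by near: t; exact: nbhs_right_lt.
have rt : \val r < t by near: t; exact: nbhs_right_gt.
have /andP[r0 _] := I01P r.
have tE : \val (clamp t) = t by rewrite clampE// (ltW t1) (le_trans r0 (ltW rt)).
by exists (clamp t); rewrite ?tE//; apply: Pt; rewrite tE.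
Unshelve. all: by end_near. Qed.

(** Right continuity at 0 determines the value there. This serves the level formulas for sums and
    multiples, which are stated on (0, 1] only. *)
Lemma Cbar_eqP (f g : Cbar R) : (forall r, 0 < \val r -> f r = g r) -> f = g.
Proof.
move=> fg; apply/val_inj/funext => r /=.
have /andP[r_ge0 _] := I01P r.
have [r0|r0] := ltP 0 (\val r); first exact: fg.
have {r_ge0} r0 : 0 = \val r by apply/le_anti; rewrite r_ge0.
apply/eqP; rewrite -subr_eq0; apply: contraT; rewrite -normr_gt0 => d0.
(* Some [s > 0] has [(f - g) s] closer to [(f - g) r] than [d0] allows, because [(f - g) s = 0]. *)
have := Cbar_right_continuous0 (CbarP (f - g)) (esym r0).
move=> /(@cvgrPdist_lt _ R^o _ (right_nbhs r))/(_ _ d0)/right_nbhs_ex.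
rewrite -r0 => /(_ ltr01)[s s0].
have -> : (f - g) s = f s - g s by [].
have -> : (f - g) r = f r - g r by [].
by rewrite (fg s)// subrr subr0 ltxx.
Qed.

End UnitInterval.

(** * Fuzzy numbers and their level functions *)

Section OfLevels.
Context {R : realType}.
Local Notation I01 := (itv_type (0 : R) 1).
Implicit Types (f g : Cbar R) (u v : fuzzy R).

Lemma IC_left f r c : IC f -> 0 < \val r -> c < f r ->
  exists2 s, \val s < \val r & c < f s.
Proof.
move=> If r0 cf; apply: left_nbhs_ex => //.
have d0 : 0 < f r - c by rewrite subr_gt0.
have := Cbar_left_continuous (CbarP f) r0.
move=> /(@cvgrPdist_lt _ R^o _ (left_nbhs r))/(_ _ d0).
by apply: filterS => s; rewrite ltr_norml; lra.
Qed.

(* The converse part of the Goetschel-Voxman representation theorem. *)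
Lemma fuzzy_of_levels f g : IC f -> IC (- g) -> (forall r, f r <= g r) ->
  exists u, fuzzy_minus u = f /\ fuzzy_plus u = g.
Proof.
move=> If Ig fg.
have gd r s : \val r <= \val s -> g s <= g r.
  by move=> /Ig; rewrite -[(- g) r]/(- g r) -[(- g) s]/(- g s) lerN2.
(* [w x] is the supremum of the levels [r] with [x] in [[f r, g r]]. Adjoining 0 keeps [A x]
   nonempty and makes [w] vanish off all these intervals. *)
pose A x := [set 0] `|` [set \val r | r in [set r | f r <= x <= g r]].
pose w x := sup (A x).
have A01 x z : A x z -> 0 <= z <= 1.
  by move=> [->|[r _ <-]]; [rewrite lexx ler01|exact: I01P].
have hsA x : has_sup (A x).
  by split; [exists 0; left|exists 1 => z /A01/andP[]].
have w01 x : 0 <= w x <= 1.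
  apply/andP; split; first by apply: ub_le_sup (hsA x).2 _ _; left.
  by apply: ge_sup (hsA x).1 _ => z /A01/andP[].
pose l r := f (clamp r); pose h r := g (clamp r).
have wE r x : 0 < r <= 1 -> (r <= w x) = (l r <= x <= h r).
  move=> /andP[r0 r1]; have rE : \val (clamp r) = r by rewrite clampE// ltW.
  have rp : 0 < \val (clamp r) by rewrite rE.
  apply/idP/idP => [rw|lxh]; last first.
    by apply: ub_le_sup (hsA x).2 _ _; right; exists (clamp r).
  (* The supremum only places [x] in the intervals of levels below [r]; left continuity of [f] and
     [- g] then reaches [r] itself. *)
  have H s : \val s < r -> f s <= x <= g s.
    move=> sr; have /andP[s0 _] := I01P s.
    have [z [->|[t /= /andP[ft tg] <-]] sz] := sup_gt (hsA x).1 (lt_le_trans sr rw).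
      by rewrite ltNge s0 in sz.
    by rewrite (le_trans (If _ _ (ltW sz)))// (le_trans _ (gd _ _ (ltW sz))).
  apply/andP; split; rewrite leNgt; apply/negP => xl.
    have [s sr] := IC_left _ _ _ If rp xl.
    by rewrite rE in sr; have /andP[fs _] := H _ sr; rewrite ltNge fs.
  have [|s sr] := IC_left (- g) (clamp r) (- x) Ig rp; first by rewrite ltrN2.
  rewrite rE in sr; have /andP[_ gs] := H _ sr.
  by rewrite -[(- g) s]/(- g s) ltrN2 ltNge gs.
have lh r : l r <= h r by exact: fg.
have fw : is_fuzzy w.
  apply: (@is_fuzzy_of_levels _ w l h w01 wE (lh 1)).
  exists (Cbar_norm f + Cbar_norm g) => r _.
  have := le_Cbar_norm f (clamp r); have := le_Cbar_norm g (clamp r).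
  by rewrite !ler_norml /l /h => /andP[? ?] /andP[? ?]; split; lra.
exists (Fuzzy fw); split; apply: Cbar_eqP => r r0 /=; have /andP[_ r1] := I01P r.
  by rewrite (level_of_levels wE _ (lh _)).1 ?r0// /l clampK.
by rewrite (level_of_levels wE _ (lh _)).2 ?r0// /h clampK.
Qed.

Lemma fdist_minus_plus u v K : `|fuzzy_minus u - fuzzy_minus v| <= K ->
  `|fuzzy_plus u - fuzzy_plus v| <= K -> mdist u v <= K.
Proof.
move=> mK pK; apply: fdist_le => r r01.
  have <- : \val (clamp r) = r by rewrite clampE//; case/andP: r01 => /ltW-> ->.
  apply: le_trans mK; exact: (le_Cbar_norm (fuzzy_minus u - fuzzy_minus v)).
have <- : \val (clamp r) = r by rewrite clampE//; case/andP: r01 => /ltW-> ->.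
apply: le_trans pK; exact: (le_Cbar_norm (fuzzy_plus u - fuzzy_plus v)).
Qed.

Lemma fuzzy_inj u v : fuzzy_minus u = fuzzy_minus v ->
  fuzzy_plus u = fuzzy_plus v -> u = v.
Proof.
move=> muv puv; apply: mdist_positivity; apply/le_anti/andP.
split; last exact: mdist_ge0.
by apply: fdist_minus_plus; rewrite ?muv ?puv subrr normr0.
Qed.

Lemma fuzzy_minus_fadd u v :
  fuzzy_minus (fadd u v) = fuzzy_minus u + fuzzy_minus v.
Proof.
apply: Cbar_eqP => r r0; have /andP[_ r1] := I01P r.
by apply: (level_fadd u v _).1; rewrite r0.
Qed.

Lemma fuzzy_plus_fadd u v :
  fuzzy_plus (fadd u v) = fuzzy_plus u + fuzzy_plus v.
Proof.
apply: Cbar_eqP => r r0; have /andP[_ r1] := I01P r.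
by apply: (level_fadd u v _).2; rewrite r0.
Qed.

(** A negative [k] exchanges the two endpoints, which their sum does not see: min plus max is the
    plain sum. So [u_- + u_+] is homogeneous for every real [k]. *)
Lemma fuzzy_sum_fscale k u : fuzzy_minus (fscale k u) + fuzzy_plus (fscale k u) =
  k *: (fuzzy_minus u + fuzzy_plus u).
Proof.
apply: Cbar_eqP => r r0; have /andP[_ r1] := I01P r.
have r01 : 0 < \val r <= 1 by rewrite r0.
have [mE pE] := level_fscale k u r01.
transitivity (level_inf (fscale k u) (\val r) + level_sup (fscale k u) (\val r)).
  by [].
by rewrite mE pE addr_min_max -mulrDr.
Qed.

Lemma fuzzy_minus_opp u : fuzzy_minus (fscale (-1) u) = - fuzzy_plus u.
Proof.
apply: Cbar_eqP => r r0; have /andP[_ r1] := I01P r.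
have r01 : 0 < \val r <= 1 by rewrite r0.
have [mE _] := level_fscale (-1) u r01.
transitivity (level_inf (fscale (-1) u) (\val r)) => //.
by rewrite mE !mulN1r min_r// lerN2; exact: level_inf_sup.
Qed.

Lemma fuzzy_plus_opp u : fuzzy_plus (fscale (-1) u) = - fuzzy_minus u.
Proof.
have := fuzzy_sum_fscale (-1) u; rewrite fuzzy_minus_opp scaleN1r opprD addrC.
exact: addIr.
Qed.

Lemma fuzzy_minus_IC u : IC (fuzzy_minus u).
Proof.
by move=> r s rs; apply: level_inf_nd => //; have /andP[] := I01P s.
Qed.

Lemma fuzzy_plus_IC u : IC (- fuzzy_plus u).
Proof.
move=> r s rs; have /andP[_ s1] := I01P s.
by have := level_sup_ni u rs s1; rewrite -lerN2.
Qed.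

End OfLevels.

(** * Splitting members of CIC into level functions, with Lipschitz estimates *)

Section ContinuousMaps.
Context {R : realType}.
Import metricType_numDomainType.

Lemma lipschitz_mdist_continuous {M N : metricType R} (phi : M -> N) K :
  0 < K -> (forall x y, mdist (phi x) (phi y) <= K * mdist x y) ->
  continuous phi.
Proof.
move=> K0 phiK x; apply/(@cvgrPdist_lt _ N _ (nbhs x)) => e e0.
have eK0 : 0 < e / K by rewrite divr_gt0.
apply/nbhs_mdistP; exists (e / K) => // y /= xy.
by rewrite (le_lt_trans (phiK x y))// mulrC -ltr_pdivlMr.
Qed.

Lemma is_Cbar_cst (c : R) : (fun=> c) \in @Cbar_pred R.
Proof.
apply/asboolP/(@is_Cbar_nondecreasing _ (cst c)) => //.
  by move=> r d /andP[r0 _] dc; exists (r / 2) => //; lra.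
by move=> d cd; exists 1 => //; rewrite ltr01 lexx.
Qed.

(** The constant function [f(1)/2]. For [f] in [IC], [f(1)] is the maximum, which is exactly what
    makes [f - half_top f <= half_top f]. *)
Definition half_top (f : Cbar R) : Cbar R := MkCbar (is_Cbar_cst (f (clamp 1) / 2)).

Lemma half_top_dist f g : `|half_top f - half_top g| <= `|f - g|.
Proof.
apply: Cbar_norm_le => r.
have := le_Cbar_norm (f - g) (clamp 1).
have -> : (half_top f - half_top g) r = (f (clamp 1) - g (clamp 1)) / 2.
  by rewrite mulrBl.
rewrite -[(f - g) (clamp 1)]/(f (clamp 1) - g (clamp 1)); apply: le_trans.
rewrite normrM [`|2^-1|]ger0_norm ?invr_ge0 ?ler0n//.
by have := normr_ge0 (f (clamp 1) - g (clamp 1)); lra.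
Qed.

Lemma half_top_continuous : continuous half_top.
Proof.
apply: (lipschitz_mdist_continuous _ 1) => // f g.
by rewrite mul1r; exact: half_top_dist.
Qed.

Context {a b : R}.
Implicit Types (F G : Cab a b (Cbar R)) (x y : Cab a b (fuzzy R)).

Definition Cab_half_top F : Cab a b (Cbar R) :=
  mk_Cab (fun t => continuous_comp (@cts_fun _ _ F t) (half_top_continuous (F t))).

(** The fuzzy numbers are chosen separately at each [t]; continuity in [t] follows because
    [fdist_minus_plus] bounds their distance by the norms of the level functions. *)
Lemma Cab_of_levels F G : CIC F -> CIC (- G) -> (forall t r, F t r <= G t r) ->
  exists x, Cab_minus x = F /\ Cab_plus x = G.
Proof.
move=> iF iG FG.
have [x xFG] := choice (fun t => fuzzy_of_levels (F t) (G t) (iF t) (iG t) (FG t)).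
have xc : continuous x.
  apply: mk_Cab_near => t e e0.
  have e20 : 0 < e / 2 by rewrite divr_gt0.
  apply: filterS2 (Cab_near F t e20) (Cab_near G t e20) => s Fs Gs.
  apply: (@le_lt_trans _ _ (e / 2)); last by lra.
  apply: fdist_minus_plus.
    by rewrite (xFG t).1 (xFG s).1; exact: ltW.
  by rewrite (xFG t).2 (xFG s).2; exact: ltW.
by exists (mk_Cab xc); split; apply: Cab_eqP => t; have [] := xFG t.
Qed.

Lemma CIC_split F : CIC F ->
  exists x, Cab_minus x = F - Cab_half_top F /\ Cab_plus x = Cab_half_top F.
Proof.
move=> iF; apply: Cab_of_levels => [t r s rs|t r s _|t r].
- by rewrite -[leLHS]/(F t r - _) -[leRHS]/(F t s - _) lerD2r; exact: iF.
- by [].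
- rewrite -[leLHS]/(F t r - F t (clamp 1) / 2) -[leRHS]/(F t (clamp 1) / 2).
  have : F t r <= F t (clamp 1).
    by apply: iF; have /andP[_ r1] := I01P r; rewrite clampE// lexx ler01.
  by lra.
Qed.

(** The factor 2 comes from the lower parts, where [F - G] and the difference of the half tops each
    contribute at most [mdist F G]. *)
Lemma CIC_split_dist F G x y :
  Cab_minus x = F - Cab_half_top F -> Cab_plus x = Cab_half_top F ->
  Cab_minus y = G - Cab_half_top G -> Cab_plus y = Cab_half_top G ->
  mdist x y <= 2 * mdist F G.
Proof.
move=> xm xp ym yp; have d0 := mdist_ge0 F G.
apply: Cab_dist_le => [|t]; first by rewrite mulr_ge0.
have FGt : `|F t - G t| <= mdist F G := le_Cab_dist F G t.
have hFG := le_trans (half_top_dist (F t) (G t)) FGt.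
apply: fdist_minus_plus.
  have -> : fuzzy_minus (x t) = F t - half_top (F t).
    exact: (congr1 (fun H : Cab a b (Cbar R) => H t) xm).
  have -> : fuzzy_minus (y t) = G t - half_top (G t).
    exact: (congr1 (fun H : Cab a b (Cbar R) => H t) ym).
  rewrite opprD addrACA -opprD (le_trans (ler_normB _ _))//.
  by rewrite mulr2n mulrDl mul1r lerD.
have -> : fuzzy_plus (x t) = half_top (F t).
  exact: (congr1 (fun H : Cab a b (Cbar R) => H t) xp).
have -> : fuzzy_plus (y t) = half_top (G t).
  exact: (congr1 (fun H : Cab a b (Cbar R) => H t) yp).
by rewrite (le_trans hFG)//; lra.
Qed.

Lemma Cab_inj x y : Cab_minus x = Cab_minus y -> Cab_plus x = Cab_plus y -> x = y.
Proof.
move=> xym xyp; apply: Cab_eqP => t; apply: fuzzy_inj.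
  exact: (congr1 (fun H : Cab a b (Cbar R) => H t) xym).
exact: (congr1 (fun H : Cab a b (Cbar R) => H t) xyp).
Qed.

Lemma Cab_minus_continuous : continuous (@Cab_minus R a b).
Proof.
apply: (lipschitz_mdist_continuous _ 1) => // x y; rewrite mul1r.
apply: Cab_dist_le => [|t]; first exact: Cab_dist_ge0.
exact: le_trans (fuzzy_minus_dist _ _) (le_Cab_dist x y t).
Qed.

Lemma Cab_opp_plus_continuous : continuous (fun x => - Cab_plus x).
Proof.
apply: (lipschitz_mdist_continuous _ 1) => // x y; rewrite mul1r.
apply: Cab_dist_le => [|t]; first exact: Cab_dist_ge0.
apply: le_trans (le_Cab_dist x y t).
apply: le_trans (fuzzy_plus_dist (x t) (y t)).
rewrite -[leLHS]/(`|- fuzzy_plus (x t) - - fuzzy_plus (y t)|).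
by rewrite -opprD normrN.
Qed.

(** * The map taking x to x_- + x_+, and the functional it induces on sums *)

Definition Cab_sum x := Cab_minus x + Cab_plus x.

Lemma Cab_sum_fadd x y : Cab_sum (Cab_fadd x y) = Cab_sum x + Cab_sum y.
Proof.
rewrite /Cab_sum addrACA; congr (_ + _); apply: Cab_eqP => t.
  exact: fuzzy_minus_fadd.
exact: fuzzy_plus_fadd.
Qed.

Lemma Cab_sum_fscale k x : Cab_sum (Cab_fscale k x) = k *: Cab_sum x.
Proof. by apply: Cab_eqP => t; exact: fuzzy_sum_fscale. Qed.

(** Multiplying by -1 turns the pair [(x_-, x_+)] into [(- x_+, - x_-)], which is the same pair when
    [x_- = - x_+]. *)
Lemma Cab_sum_eq0 x : Cab_sum x = 0 -> Cab_fscale (-1) x = x.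
Proof.
move=> /eqP; rewrite addr_eq0 => /eqP xmp; apply: Cab_inj.
  by rewrite xmp; apply: Cab_eqP => t; exact: fuzzy_minus_opp.
have -> : Cab_plus x = - Cab_minus x by rewrite xmp opprK.
by apply: Cab_eqP => t; exact: fuzzy_plus_opp.
Qed.

Lemma fuzzy_linear_graph (A : Cab a b (fuzzy R) -> R) : fuzzy_linear A ->
  linear_graph [set (Cab_sum x, A x) | x in setT].
Proof.
move=> [AD AZ]; split.
(* Any [x] would do, as [Cab_fscale 0 x] has sum 0 and value 0; the zero level functions supply
   one. *)
- have [x _] := Cab_of_levels 0 0 (fun _ _ _ _ => lexx _) (fun _ _ _ _ => lexx _)
                              (fun _ _ => lexx _).
  by exists (Cab_fscale 0 x) => //; rewrite Cab_sum_fscale AZ scale0r mul0r.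
- move=> k _ _ _ _ [x _ /pair_equal_spec[<- <-]] [y _ /pair_equal_spec[<- <-]].
  by exists (Cab_fadd (Cab_fscale k x) y); rewrite // Cab_sum_fadd Cab_sum_fscale AD AZ.
- move=> r [x _ /pair_equal_spec[/Cab_sum_eq0 xE <-]].
  (* Here [(-1) x = x], so [A x = - A x]. *)
  by have := AZ (-1) x; rewrite xE; lra.
Qed.

End ContinuousMaps.

(** * Transfer of continuity between [xstar] and [L] *)

Theorem theorem3p5 (R : realType) (a b : R) (hab : a < b)
    (xstar : Cab a b (fuzzy R) -> R) :
  (fuzzy_linear xstar /\ continuous xstar) <->
  (exists L : {scalar Cab a b (Cbar R)},
     (forall x : Cab a b (fuzzy R), xstar x = L (Cab_minus x + Cab_plus x)) /\
     {within @CIC R a b, continuous L}).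
Proof.
split=> [[lin cont]|[L [xL contL]]].
- have [L LE] := linear_graph_total _ (fuzzy_linear_graph _ lin).
  have xL x : xstar x = L (Cab_sum x) by rewrite (LE _ (xstar x))//; exists x.
  exists L; split => //; apply/subspace_continuousP => F iF.
  have [x [xm xp]] := CIC_split F iF.
  apply/(@cvgrPdist_lt _ R^o _ (within (@CIC R a b) (nbhs F))) => e e0.
  (* The two parts of the splitting add up to [G], so on CIC the values of [L] are values of
     [xstar]. *)
  have LS G y : Cab_minus y = G - Cab_half_top G -> Cab_plus y = Cab_half_top G ->
      L G = xstar y.
    by rewrite xL /Cab_sum => -> ->; rewrite subrK.
  have [d /= d0 Hd] := (metricType_numDomainType.nbhs_mdistP _ _).1
    ((@cvgrPdist_lt _ R^o _ (nbhs x) _ xstar (xstar x)).1 (cont x) e e0).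
  apply: (metricType_numDomainType.nbhs_mdistP _ (fun G => CIC G -> _)).2.
  (* Halving [d] absorbs the Lipschitz constant 2 of the splitting. *)
  exists (d / 2); rewrite /= ?divr_gt0// => G /= FG iG.
  have [y [ym yp]] := CIC_split G iG.
  have : `|xstar x - xstar y| < e; last first.
    by rewrite -(LS F x xm xp) -(LS G y ym yp).
  by apply: Hd; rewrite /= (le_lt_trans (CIC_split_dist _ _ _ _ xm xp ym yp))//; lra.
- split.
    split=> [x y|k x]; first by rewrite !xL -linearD -/(Cab_sum _) Cab_sum_fadd.
    by rewrite !xL -/(Cab_sum _) Cab_sum_fscale linearZ.
  (* The sign is moved inside because [- x_+], being increasing in the level, lies in CIC, where [L]
     is known to be continuous. *)
  move=> x; have -> : xstar = fun y => L (Cab_minus y) - L (- Cab_plus y).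
    by apply/funext => y; rewrite xL linearD linearN opprK.
  have comp (phi : Cab a b (fuzzy R) -> Cab a b (Cbar R)) : continuous phi ->
      (forall y, CIC (phi y)) -> L (phi y) @[y --> x] --> L (phi x).
    move=> cphi iphi.
    apply: cvg_comp ((subspace_continuousP _ _).1 contL _ (iphi x)).
    move=> P /(cphi x); apply: (@filterS _ (nbhs x)) => y; apply; exact: iphi.
  apply: (@cvgB _ R^o _ (nbhs x)).
    by apply: comp Cab_minus_continuous _ => y t; exact: fuzzy_minus_IC.
  by apply: comp Cab_opp_plus_continuous _ => y t; exact: fuzzy_plus_IC.
Qed.
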